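(* Let $n\ge 1$ be an integer, let $\alpha, c$ be real numbers, and let $HC_n$ be the honeycomb network of dimension $n$. Then $$\Pi_{1,c}(HC_n)=2^{6nc}\,3^{6n^2c-6nc},$$ $$\Pi_2(HC_n)=2^{12n}\,3^{18n^2-18n},$$ $$\chi_\alpha(HC_n)=3\cdot 2^{2\alpha+1}+12(n-1)5^\alpha+2^\alpha 3^{\alpha+1}(3n^2-5n+2),$$ $$\Pi_1^*(HC_n)=2^{9n^2-15n+18}\,3^{9n^2-15n+6}\,5^{12(n-1)}.$$
   Context: All graphs are finite, simple and connected; $d(v)$ is the degree of the vertex $v$ in $G=(V(G),E(G))$. For real $c,\alpha$ define $$\Pi_{1,c}(G)=\prod_{v\in V(G)}d(v)^c,\quad \Pi_2(G)=\prod_{uv\in E(G)}d(u)d(v)=\prod_{u\in V(G)}d(u)^{d(u)},$$ $$\Pi_1^*(G)=\prod_{uv\in E(G)}(d(u)+d(v)),\quad \chi_\alpha(G)=\sum_{uv\in E(G)}(d(u)+d(v))^\alpha.$$ Honeycomb network $HC_n$: $HC_1$ is a hexagon (6-cycle), and $HC_n$ is obtained from $HC_{n-1}$ by adding a layer of hexagons of the regular hexagonal tiling of the plane around the boundary of $HC_{n-1}$. Equivalently, $HC_n$ consists of the vertices and edges of all hexagons of the tiling at distance at most $n-1$ from a fixed central hexagon, where distance is the graph distance in which two hexagons are adjacent when they share an edge. Thus $|V(HC_n)|=6n^2$ and $|E(HC_n)|=9n^2-3n$. *)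

(* Defs.v *)
From HB Require Import structures.
From mathcomp Require Import all_boot all_order all_algebra.
From mathcomp Require Import finmap.
From mathcomp Require Import reals exp.

Set Implicit Arguments.
Unset Strict Implicit.
Unset Printing Implicit Defensive.

Import Order.TTheory GRing.Theory Num.Theory.

Local Open Scope ring_scope.

Record sgraph := SGraph {
  vertex :> finType;
  adj : rel vertex;
  adj_sym : symmetric adj;
  adj_irr : irreflexive adj }.

Definition deg (G : sgraph) (v : G) : nat := #|[set w | adj v w]|.

(* Edges are unordered pairs, so that each edge occurs once in a product or
   sum over [edges G]; for such an [e = [set u; v]], the inner products and
   sums over [e] below are d(u)d(v) and d(u) + d(v). *)
Definition edges (G : sgraph) : {set {set G}} :=
  [set [set p.1; p.2] | p in [pred p : G * G | adj p.1 p.2]].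

Definition Pi1 (R : realType) (c : R) (G : sgraph) : R :=
  \prod_(v : G) (deg v)%:R `^ c.

Definition Pi2 (G : sgraph) : nat :=
  (\prod_(e in edges G) \prod_(v in e) deg v)%N.

Definition Pi1star (G : sgraph) : nat :=
  (\prod_(e in edges G) \sum_(v in e) deg v)%N.

Definition chi (R : realType) (alpha : R) (G : sgraph) : R :=
  \sum_(e in edges G) (\sum_(v in e) deg v)%N%:R `^ alpha.

(* The regular hexagonal tiling with unit sides is drawn in the triangular
   lattice: (a, b) stands for the point a + b w of the complex plane, where
   w = exp(i pi / 3), so w ^ 2 = w - 1.  Lattice points serve both as centres
   of hexagons and as corners; the tiling is the one having a hexagon centred
   at the origin. *)
Definition point := (int * int)%type.

(* Multiplication by w, i.e. rotation by 60 degrees. *)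
Definition rot60 (u : point) : point := (- u.2, u.1 + u.2).

Definition units : seq point := traject rot60 (1, 0) 6.

(* The hexagon with centre p has the corners p + u and the sides joining p + u
   to p + w u, for u a sixth root of unity. *)
Definition corners (p : point) : {fset point} := [fset (p + u)%R | u in units]%fset.

Definition side (p x y : point) : bool :=
  has (fun u => ((x, y) == (p + u, p + rot60 u))
             || ((y, x) == (p + u, p + rot60 u))) units.

Definition hex_adj (p q : point) : Prop :=
  p <> q /\ exists x y, side p x y /\ side q x y.

(* Centres of the hexagons sharing a side with the one centred at p, obtained
   by reflecting p in each of its six sides; see [hex_nbrsP]. *)
Definition hex_nbrs (p : point) : seq point :=
  [seq p + (u + rot60 u) | u <- units].

(* Centres of the hexagons at distance at most k from the central one; see
   [hex_ballP]. *)
Fixpoint hex_ball (k : nat) : {fset point} :=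
  if k is k'.+1
  then (hex_ball k' `|` [fset q | p in hex_ball k', q in hex_nbrs p])%fset
  else [fset 0%R]%fset.

Lemma hex_nbrsP (p q : point) : hex_adj p q <-> q \in hex_nbrs p.
Proof.
have subDl (r v w : point) : (r + v) - (r + w) = v - w.
  by rewrite opprD addrACA subrr add0r.
have same : all (fun u => all (fun u' =>
    (rot60 u - u == rot60 u' - u') ==> (u == u')) units) units by [].
have opp : all (fun u => all (fun u' =>
    (rot60 u - u == u' - rot60 u') ==> (rot60 u == - rot60 u')) units) units.
  by [].
have sides u u' : u \in units -> u' \in units ->
  p + u = q + u' -> p + rot60 u = q + rot60 u' -> p = q.
  move=> uin u'in e1 e2; have /allP/(_ _ u'in)/implyP h := allP same _ uin.
  have /h/eqP eu : rot60 u - u == rot60 u' - u'.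
    by rewrite -(subDl p) e2 e1 subDl.
  by move: e1; rewrite eu => /addIr.
have flip u u' : u \in units -> u' \in units ->
  p + u = q + rot60 u' -> p + rot60 u = q + u' -> q \in hex_nbrs p.
  move=> uin u'in e1 e2; have /allP/(_ _ u'in)/implyP h := allP opp _ uin.
  have /h/eqP eu : rot60 u - u == u' - rot60 u'.
    by rewrite -(subDl p) e2 e1 subDl.
  by apply/mapP; exists u => //; rewrite addrA e1 eu addrK.
split=> [[pq [x [y [/hasP[u uin xy] /hasP[u' u'in xy']]]]]|].
  case/orP: xy => /eqP[ex ey]; case/orP: xy' => /eqP[ex' ey'].
  - by case: pq; apply: (sides u u') => //; rewrite -?ex -?ey.
  - by apply: (flip u u') => //; rewrite -?ex -?ey.
  - by apply: (flip u u') => //; rewrite -?ex -?ey.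
  - by case: pq; apply: (sides u u') => //; rewrite -?ex -?ey.
case/mapP=> u uin ->; split.
  move=> e; have: u + rot60 u != 0 by move: u uin {e}; apply/allP.
  by rewrite -(inj_eq (addrI p)) -e addr0 eqxx.
have sub_rot (v w z : point) : v = w + z -> p + v = p + w + z.
  by move=> ->; rewrite addrA.
exists (p + u), (p + rot60 u); split; apply/hasP.
  by exists u => //; rewrite eqxx.
exists (- u); first by move: u uin; apply/allP.
rewrite -(sub_rot (rot60 u)) -?(sub_rot u) ?eqxx ?orbT //.
  by apply/eqP; move: u uin; apply/allP.
by rewrite addrAC subrr add0r.
Qed.

Fixpoint hex_walk (p : point) (s : seq point) : Prop :=
  if s is q :: s' then hex_adj p q /\ hex_walk q s' else True.

Lemma hex_ballP (k : nat) (q : point) :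
  q \in hex_ball k <->
  exists s, [/\ hex_walk 0 s, (size s <= k)%N & last 0 s = q].
Proof.
have walk_rcons p s r :
    hex_walk p (rcons s r) <-> hex_walk p s /\ hex_adj (last p s) r.
  elim: s p => [|t s IHs] p /=; first by split=> -[].
  by rewrite IHs; split=> [[? []]|[[]]].
elim: k q => [|k IHk] q /=.
  rewrite inE; split=> [/eqP->|[[|? ?] [_ //= _ ->]]]; last by rewrite eqxx.
  by exists [::].
rewrite in_fsetU; split.
  case/orP=> [/IHk[s [ws lesk <-]]|/imfset2P[p pin [r rin ->]]].
    by exists s; split=> //; apply: leqW.
  have /IHk[s [ws lesk ls]] := pin.
  exists (rcons s r); rewrite size_rcons last_rcons ltnS; split=> //.
  by apply/walk_rcons; split=> //; rewrite ls; apply/hex_nbrsP.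
case=> s; case/lastP: s => [|s r] [].
  by move=> _ _ <-; apply/orP; left; apply/IHk; exists [::].
rewrite size_rcons last_rcons ltnS => /walk_rcons[ws /hex_nbrsP rin] lesk <-.
apply/orP; right; apply/imfset2P; exists (last 0 s).
  by apply/IHk; exists s.
by exists r.
Qed.

Definition HC_vertices (n : nat) : {fset point} :=
  (\bigcup_(p <- hex_ball n.-1) corners p)%fset.

Definition HC_adj (n : nat) : rel (HC_vertices n) :=
  fun x y => [exists p : hex_ball n.-1, side (val p) (val x) (val y)].

Lemma side_sym p : symmetric (side p).
Proof. by move=> x y; apply: eq_has => u; rewrite orbC. Qed.

Lemma side_irr p : irreflexive (side p).
Proof.
move=> x; apply/hasPn => u; rewrite orbb => uin; apply/eqP => -[-> /addrI/eqP].
by apply/negP; move: u uin; apply/allP.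
Qed.

Lemma HC_adj_sym n : symmetric (@HC_adj n).
Proof. by move=> x y; apply: eq_existsb => p; rewrite side_sym. Qed.

Lemma HC_adj_irr n : irreflexive (@HC_adj n).
Proof. by move=> x; apply/existsP => -[p]; rewrite side_irr. Qed.

Definition HC (n : nat) : sgraph :=
  SGraph (@HC_adj_sym n) (@HC_adj_irr n).

(* Main.v *)
Require Import Defs.
From mathcomp Require Import all_boot all_order all_algebra.
From mathcomp Require Import finmap zify ring.
From mathcomp Require Import reals exp.

(** The plane is the projection of the cubic lattice along (1, 1, 1): write
    [cell x y z] for the image of (x, y, z).  The hexagon centres are then the
    triples of sum 0, the corners the triples of sum -1 or -2, and every point
    has exactly one such name.  The hexagons at distance at most k from the
    central one are the triples of sum 0 with all entries in [-k, k]
    ([hex_ballE]): from a centre other than 0, one entry is positive and another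
    negative, and moving both by one towards 0 is a step to a neighbour.

    Rotation by 60 degrees is an automorphism of HC_n ([adj_rotv]), and the
    vertices split into six rotated copies of the n x n array of the points
    [sector_pt i j], of coordinates (i, -1-j, j-i) ([HC_sectors], [big_HC]).
    Indeed a triple of sum -1 has exactly one cyclic change from a nonnegative
    to a negative entry, and rotating turns the sum -1 into -2.  Inspection
    of the three hexagons around a vertex of the array gives its neighbours
    ([adj_sector]): it has degree 2 when j = n-1 and degree 3 otherwise, so
    there are 6n vertices of degree 2 and 6n(n-1) of degree 3.  This gives
    the first product, and the second one too because in an edge product each
    vertex contributes as many factors as its degree ([handshake]).

    For the other two indices one counts the edges by the sum s of the degrees
    of their ends, which is 4, 5 or 6.  Handshaking gives two equations: the
    sum of the degrees is twice the number of edges, and the sum of the squared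
    degrees is the sum of s over the edges.  The third is that only
    six edges have s = 4 ([HC_darts22]): they join the end of one of the six
    arrays to the start of another along the boundary.  Solving, the
    numbers are 6, 12m and 3m(3m+1) where n = m+1 ([HC_edge_nums]). *)

Import Order.TTheory GRing.Theory Num.Theory.

Local Open Scope ring_scope.

(** * Coordinates and the ball of hexagons *)

(** In the basis (1, w) the three coordinate axes go to 1, w ^ 2 and w ^ 4,
    whose sum is 0. *)
Definition cell (x y z : int) : point := (x - y, y - z).

Definition in_ball (k : nat) (x y z : int) : bool :=
  [&& (- k%:Z <= x <= k%:Z), (- k%:Z <= y <= k%:Z) & (- k%:Z <= z <= k%:Z)].

Lemma cellD x y z x' y' z' :
  cell x y z + cell x' y' z' = cell (x + x') (y + y') (z + z').
Proof. by rewrite /cell; congr pair; rewrite /=; lia. Qed.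

Lemma cellN x y z : - cell x y z = cell (- x) (- y) (- z).
Proof. by rewrite /cell; congr pair; rewrite /=; lia. Qed.

Lemma rot60_cell x y z : rot60 (cell x y z) = cell (- y) (- z) (- x).
Proof. by rewrite /cell /rot60 /=; congr pair; lia. Qed.

Lemma cell_eqP x y z x' y' z' : cell x y z = cell x' y' z' <->
  x - x' = y - y' /\ y - y' = z - z'.
Proof.
rewrite /cell; split=> [[h1 h2]|[h1 h2]]; first by split; lia.
by congr pair; lia.
Qed.

Lemma unitsE : units =
  [:: cell 1 0 0; cell 0 0 (-1); cell 0 1 0; cell (-1) 0 0; cell 0 0 1;
      cell 0 (-1) 0].
Proof. by []. Qed.

Lemma hex_nbrs_cellE x y z : hex_nbrs (cell x y z) =
  [:: cell (x + 1) y (z - 1); cell x (y + 1) (z - 1); cell (x - 1) (y + 1) z;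
      cell (x - 1) y (z + 1); cell x (y - 1) (z + 1); cell (x + 1) (y - 1) z].
Proof.
rewrite /hex_nbrs unitsE /= !rot60_cell !cellD.
by do 6?congr cons; apply/cell_eqP; lia.
Qed.

(** A candidate for the previous centre must lie in the smaller ball and have
    the target among its neighbours. *)
Local Ltac step_from step x y z := apply: (step x y z);
  first [by rewrite /in_ball; lia
        | by rewrite hex_nbrs_cellE !subrK ?addrK !inE !eqxx ?orbT].

(** The step onto the sphere of radius k+1 comes from moving a positive and a
    negative coordinate towards 0.  The third coordinate needs no change: if it
    were k+1 in absolute value, the other two would sum to k+1 in absolute value
    with opposite signs, and one of them would exceed k+1 in absolute value. *)
Lemma hex_ballE k p : p \in hex_ball k <->
  exists x y z, [/\ x + y + z = 0, in_ball k x y z & p = cell x y z].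
Proof.
elim: k p => [|k IHk] p /=.
  rewrite inE; split=> [/eqP->|[x [y [z [s h ->]]]]].
    by exists 0, 0, 0.
  by move: h; rewrite /in_ball => h; apply/eqP; rewrite /cell; congr pair; lia.
rewrite in_fsetU; split.
  case/orP=> [/IHk[x [y [z [s h ->]]]]|].
    by exists x, y, z; split=> //; move: h; rewrite /in_ball; lia.
  case/imfset2P=> q /IHk[x [y [z [s h ->]]]] [r].
  rewrite hex_nbrs_cellE => rin ->.
  move: rin h; rewrite /in_ball !inE => /or4P[|||/or3P[]] /eqP -> h;
    do 3 eexists; (split; last by reflexivity); lia.
case=> x [y [z [s h ->]]].
have [xyz|xyz] := boolP (in_ball k x y z).
  by apply/orP; left; apply/IHk; exists x, y, z.
apply/orP; right; apply/imfset2P.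
have step x' y' z' : x' + y' + z' = 0 -> in_ball k x' y' z' ->
    cell x y z \in hex_nbrs (cell x' y' z') ->
    exists2 p, p \in hex_ball k &
      exists2 q, q \in hex_nbrs p & cell x y z = q.
  move=> s' h' n'; exists (cell x' y' z'); last by exists (cell x y z).
  by apply/IHk; exists x', y', z'.
(* Which pair of coordinates moves depends on the signs of x and y. *)
have [x0|x0|x0] := ltgtP x 0; have [y0|y0|y0] := ltgtP y 0.
all: move: h xyz; rewrite /in_ball => h xyz.
all: first
  [ step_from step (x - 1) (y + 1) z | step_from step (x + 1) (y - 1) z
  | step_from step (x - 1) y (z + 1) | step_from step (x + 1) y (z - 1)
  | step_from step x (y - 1) (z + 1) | step_from step x (y + 1) (z - 1) ].
Qed.

Lemma cell_in_hex_ball k x y z : x + y + z = 0 ->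
  (cell x y z \in hex_ball k) = in_ball k x y z.
Proof.
move=> s; apply/idP/idP => [/hex_ballE[x' [y' [z' [s' h /cell_eqP e]]]]|h].
  by move: h; rewrite /in_ball; lia.
by apply/hex_ballE; exists x, y, z.
Qed.

(** A corner is no centre: cubic triples are determined up to multiples of
    (1, 1, 1), so the sum modulo 3 is a property of the point. *)
Lemma cell_notin_hex_ball k x y z : x + y + z = - 2 ->
  (cell x y z \in hex_ball k) = false.
Proof.
by move=> s; apply/negP => /hex_ballE[x' [y' [z' [s' h /cell_eqP e]]]]; lia.
Qed.

(** * The honeycomb network and its rotation *)

Lemma rot60D : {morph rot60 : p q / p + q}.
Proof. by case=> a b [c d]; rewrite /rot60 /=; congr pair; rewrite /=; lia. Qed.

Lemma iter_rot60_6 p : iter 6 rot60 p = p.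
Proof. by case: p => a b; rewrite /rot60 /=; congr pair; lia. Qed.

Lemma rot60_inj : injective rot60.
Proof.
by apply: (can_inj (g := iter 5 rot60)) => p; rewrite -iterSr iter_rot60_6.
Qed.

Lemma rot60_hex_ball k p : p \in hex_ball k -> rot60 p \in hex_ball k.
Proof.
case/hex_ballE=> x [y [z [s h ->]]]; apply/hex_ballE.
exists (- y), (- z), (- x); split; last exact: rot60_cell; first by lia.
by move: h; rewrite /in_ball; lia.
Qed.

Lemma iter_rot60_hex_ball k r p :
  p \in hex_ball k -> iter r rot60 p \in hex_ball k.
Proof. by move=> pin; elim: r => //= r; apply: rot60_hex_ball. Qed.

Lemma mem_rot60_units : [seq rot60 u | u <- units] =i units.
Proof. by move=> u; rewrite (mem_rot 1 units). Qed.

Lemma iter_rot60_units r u : u \in units -> iter r rot60 u \in units.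
Proof. by move=> uin; elim: r => //= r IHr; rewrite -mem_rot60_units map_f. Qed.

Lemma side_rot60 p x y : side (rot60 p) (rot60 x) (rot60 y) = side p x y.
Proof.
rewrite /side -(eq_has_r mem_rot60_units) has_map; apply: eq_has => u.
have pairE (a b c d : point) : ((a, b) == (c, d)) = (a == c) && (b == d) by [].
by rewrite /preim /= !pairE -!rot60D !(inj_eq rot60_inj).
Qed.

Lemma HC_verticesP n x : reflect
  (exists2 p, p \in hex_ball n.-1 & exists2 u, u \in units & x = p + u)
  (x \in HC_vertices n).
Proof.
rewrite /HC_vertices.
apply: (iffP (bigfcupP _ _ _ _)) => [[p]|[p pin [u uin ->]]].
  by rewrite andbT => pin /imfsetP[u uin ->]; exists p => //; exists u.
by exists p; rewrite ?pin //; apply: in_imfset.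
Qed.

Lemma HC_adjP n (v w : HC n) : reflect
  (exists2 p, p \in hex_ball n.-1 & side p (val v) (val w)) (adj v w).
Proof.
apply: (iffP existsP) => [[p h]|[p pin h]].
  by exists (val p); [apply: valP | ].
by exists [` pin]%fset.
Qed.

Lemma rot60_HC n x : x \in HC_vertices n -> rot60 x \in HC_vertices n.
Proof.
case/HC_verticesP=> p pin [u uin ->]; apply/HC_verticesP.
exists (rot60 p); first exact: rot60_hex_ball.
by exists (rot60 u); [rewrite -mem_rot60_units map_f | rewrite rot60D].
Qed.

Definition rotv {n} (v : HC n) : HC n := [` rot60_HC _ _ (valP v)]%fset.

Lemma val_rotv n (v : HC n) : val (rotv v) = rot60 (val v).
Proof. by []. Qed.

Lemma val_iter_rotv n r (v : HC n) : val (iter r rotv v) = iter r rot60 (val v).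
Proof. by elim: r => //= r ->. Qed.

Lemma iter_rotv_6 n (v : HC n) : iter 6 rotv v = v.
Proof. by apply: val_inj; rewrite val_iter_rotv iter_rot60_6. Qed.

Lemma rotv_inj n : injective (@rotv n).
Proof. by move=> v w /(congr1 val)/rot60_inj/val_inj. Qed.

(** One direction is the invariance of the ball and of the sides; the other
    follows by rotating five more times. *)
Lemma adj_rotv n (v w : HC n) : adj (rotv v) (rotv w) = adj v w.
Proof.
have rot (v' w' : HC n) : adj v' w' -> adj (rotv v') (rotv w').
  case/HC_adjP=> p pin h; apply/HC_adjP.
  by exists (rot60 p); rewrite ?rot60_hex_ball ?side_rot60.
have rotr r (v' w' : HC n) : adj v' w' -> adj (iter r rotv v') (iter r rotv w').
  by move=> h; elim: r => //= r /rot.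
apply/idP/idP => [/(rotr 5%N)|/rot //].
by rewrite -!iterSr !iter_rotv_6.
Qed.

Lemma sum_adj_rotv n (F : HC n -> nat) r v : (forall w, F (rotv w) = F w) ->
  (\sum_(w | adj (iter r rotv v) w) F w = \sum_(w | adj v w) F w)%N.
Proof.
move=> FE; elim: r => [//|r <-]; rewrite iterS.
rewrite (reindex_inj (@rotv_inj n)); apply: eq_big => w; last by rewrite FE.
by rewrite adj_rotv.
Qed.

Lemma degE (G : sgraph) (v : G) : deg v = (\sum_(w | adj v w) 1)%N.
Proof. by rewrite sum1_card /deg cardsE. Qed.

Lemma deg_iter_rotv n r (v : HC n) : deg (iter r rotv v) = deg v.
Proof. by rewrite !degE sum_adj_rotv. Qed.

(** A corner v has the six points v - u around it, those in the ball being the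
    centres of its hexagons; the sides at v of the hexagon centred at v - u
    leave v at 120 degrees on either side of u. *)
Lemma HC_adjE n (v w : HC n) : adj v w =
  has (fun u => (val v - u \in hex_ball n.-1) &&
    (val w \in [:: val v + iter 2 rot60 u; val v + iter 4 rot60 u])) units.
Proof.
have diff u : u \in units -> [/\ rot60 u - u = iter 2 rot60 u,
    u - rot60 u = iter 5 rot60 u & iter 5 rot60 u - u = iter 4 rot60 u].
  by rewrite unitsE !inE => /or4P[|||/or3P[]] /eqP->.
apply/HC_adjP/hasP => [[p pin /hasP[u uin /orP[]/eqP[ev ew]]]|].
- have [e _ _] := diff u uin.
  exists u => //; rewrite [val v]ev addrK pin !inE [val w]ew -e.
  by rewrite addrACA subrr addr0 addrC eqxx.
- have [_ e _] := diff u uin.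
  exists (rot60 u); first by rewrite -mem_rot60_units map_f.
  rewrite [val v]ew addrK pin !inE [val w]ev -(iterSr 4) -e.
  by rewrite addrACA subrr addr0 eqxx orbT.
case=> u uin /andP[pin]; have [e2 _ e4] := diff u uin.
rewrite -e2 -e4 !inE => /orP[]/eqP ew; exists (val v - u) => //; apply/hasP.
  by exists u => //; rewrite subrK ew addrA addrAC eqxx.
exists (iter 5 rot60 u); first exact: iter_rot60_units.
by rewrite -iterS iter_rot60_6 subrK ew addrA addrAC eqxx orbT.
Qed.

(** * Six sectors *)

(** The triples of sum -1 whose first entry is nonnegative and whose second
    entry is negative; the third entry is then automatically in range. *)
Definition sector_pt (i j : nat) : point :=
  cell i%:Z (- 1 - j%:Z) (j%:Z - i%:Z).

(** The hexagon centred one step up in the second coordinate is always in the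
    ball, even on the boundary of the network. *)
Lemma sector_pt_HC m (i j : 'I_m.+1) : sector_pt i j \in HC_vertices m.+1.
Proof.
apply/HC_verticesP; exists (cell i%:Z (- j%:Z) (j%:Z - i%:Z)).
  rewrite cell_in_hex_ball; last by lia.
  by have := ltn_ord i; have := ltn_ord j; rewrite /in_ball /=; lia.
exists (cell 0 (-1) 0); first by rewrite unitsE !inE eqxx !orbT.
by rewrite cellD; apply/cell_eqP; lia.
Qed.

Definition sector_vtx {m} (i j : 'I_m.+1) : HC m.+1 :=
  [` sector_pt_HC m i j]%fset.

Lemma iter_rot60_mod r p : iter r rot60 p = iter (r %% 6) rot60 p.
Proof.
rewrite {1}(divn_eq r 6) addnC iterD; congr (iter _ _ _).
by elim: (r %/ 6)%N => // q IHq; rewrite mulSn iterD IHq iter_rot60_6.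
Qed.

(** Up to rotation the corner is q + cell 0 (-1) 0 with q a centre in the ball:
    a triple of sum -1.  Its signs are mixed, since three nonnegative entries
    have sum at least 0 and three negative ones at most -3, so exactly one entry
    is nonnegative and followed cyclically by a negative one; rotating by 120
    degrees permutes the entries cyclically and brings it in front. *)
Lemma HC_sectors m x : x \in HC_vertices m.+1 ->
  exists r : 'I_6, exists i j : 'I_m.+1, x = iter r rot60 (sector_pt i j).
Proof.
case/HC_verticesP=> p pin [u uin ->].
suff {u uin}: forall s q, q \in hex_ball m -> exists r, exists i j : 'I_m.+1,
    q + iter s rot60 (cell 0 (-1) 0) = iter r rot60 (sector_pt i j).
  move=> cover; have [s us] : exists s, u = iter s rot60 (cell 0 (-1) 0).
    move: uin; rewrite unitsE !inE => /or4P[|||/or3P[]] /eqP ->.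
    - by exists 1%N. - by exists 2%N. - by exists 3%N.
    - by exists 4%N. - by exists 5%N. - by exists 0%N.
  have [r [i [j e]]] := cover s p pin.
  exists (Ordinal (ltn_pmod r (isT : 0 < 6)%N)), i, j.
  by rewrite us e iter_rot60_mod.
elim=> [|s IHs] q qin.
  have /hex_ballE[x' [y' [z' [s h ->]]]] := qin.
  have sector r (a b c : int) : 0 <= a -> b < 0 -> a + b + c = - 1 ->
      a <= m%:Z -> - m%:Z - 1 <= b ->
      iter r rot60 (cell a b c) = cell x' y' z' + cell 0 (-1) 0 ->
      exists r, exists i j : 'I_m.+1,
        cell x' y' z' + cell 0 (-1) 0 = iter r rot60 (sector_pt i j).
    move=> a0 b0 abc am bm <-.
    have im : (`|a| < m.+1)%N by lia.
    have jm : (absz (b + 1)%R < m.+1)%N by lia.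
    exists r, (Ordinal im), (Ordinal jm); congr (iter _ _ _).
    by apply/cell_eqP; rewrite /=; lia.
  move: h; rewrite /in_ball => h.
  have [x0|x0] := leP 0 x'; have [y0|y0] := leP y' 0.
  - apply: (sector 0%N x' (y' - 1) z') => //; try lia.
    by rewrite cellD; apply/cell_eqP; lia.
  - apply: (sector 2%N (y' - 1) z' x'); try lia.
    by rewrite /= !rot60_cell cellD; apply/cell_eqP; lia.
  - apply: (sector 4%N z' x' (y' - 1)); try lia.
    by rewrite /= !rot60_cell cellD; apply/cell_eqP; lia.
  - have [z0|z0] := leP 0 z'.
      apply: (sector 4%N z' x' (y' - 1)); try lia.
      by rewrite /= !rot60_cell cellD; apply/cell_eqP; lia.
    apply: (sector 2%N (y' - 1) z' x'); try lia.
    by rewrite /= !rot60_cell cellD; apply/cell_eqP; lia.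
have [r [i [j e]]] := IHs _ (iter_rot60_hex_ball _ 5 _ qin).
(* Rotating by 300 degrees undoes one of the s + 1 rotations. *)
exists r.+1, i, j; rewrite [RHS]iterS -e rot60D -(iterS 5).
by rewrite iter_rot60_6.
Qed.

(** Up to a common rotation r = 0.  An odd number r' of rotations turns the sum
    -1 into -2; the even numbers 2 and 4 permute the entries cyclically and move
    the sign change away from the front. *)
Lemma sector_pt_inj r i j r' i' j' : (r < 6)%N -> (r' < 6)%N ->
  iter r rot60 (sector_pt i j) = iter r' rot60 (sector_pt i' j') ->
  [/\ r = r', i = i' & j = j'].
Proof.
wlog le_rr : r i j r' i' j' / (r <= r')%N.
  move=> wl r6 r6'; have [|/ltnW] := leqP r r'.
    by move=> le_rr; apply: wl.
  by move=> le_rr /esym/(wl _ _ _ _ _ _ le_rr r6' r6)[-> -> ->].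
move=> _ r6' e.
have {e} : sector_pt i j = iter (r' - r)%N rot60 (sector_pt i' j').
  have rinj : injective (iter r rot60).
    by elim: {le_rr e} r => // r IHr p q /rot60_inj/IHr.
  by apply: rinj; rewrite e -iterD subnKC.
have: ((r' - r)%N < 6)%N by lia.
case dE: (r' - r)%N => [|[|[|[|[|[|d]]]]]] // _.
all: rewrite /sector_pt /= ?rot60_cell => /cell_eqP e.
all: split; lia.
Qed.

Lemma big_HC {T} (idx : T) (op : Monoid.com_law idx) m (F : HC m.+1 -> T) :
  \big[op/idx]_v F v = \big[op/idx]_(r < 6) \big[op/idx]_(i < m.+1)
    \big[op/idx]_(j < m.+1) F (iter r rotv (sector_vtx i j)).
Proof.
under [RHS]eq_bigr do rewrite pair_big.
rewrite pair_big /=.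
pose g (t : 'I_6 * ('I_m.+1 * 'I_m.+1)) : HC m.+1 :=
  iter t.1 rotv (sector_vtx t.2.1 t.2.2).
have g_inj : injective g.
  case=> r [i j] [r' [i' j']] /(congr1 val); rewrite !val_iter_rotv /=.
  by case/sector_pt_inj=> // /val_inj-> /val_inj-> /val_inj->.
have permg : perm_eq (index_enum (HC m.+1)) (map g (index_enum _)).
  apply: uniq_perm; rewrite ?map_inj_uniq ?index_enum_uniq // => v.
  rewrite mem_index_enum; apply/esym/mapP.
  have [r [i [j e]]] := HC_sectors _ _ (valP v).
  exists (r, (i, j)); first by rewrite mem_index_enum.
  by apply: val_inj; rewrite val_iter_rotv.
by rewrite (perm_big _ permg) big_map.
Qed.

(** * Degrees *)

(** Of the three hexagons around (i, -1-j, j-i), the one obtained by increasing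
    the second entry is in the ball, and it carries the two sides that decrease
    the first or the third entry.  The side decreasing the second entry belongs
    to the other two hexagons, whose second entry -1-j requires j < m; then the
    one obtained by increasing the third entry is in the ball. *)
Lemma adj_sector m (i j : 'I_m.+1) (w : HC m.+1) : adj (sector_vtx i j) w =
  (val w \in [:: cell (i%:Z - 1) (- 1 - j%:Z) (j%:Z - i%:Z);
                 cell i%:Z (- 1 - j%:Z) (j%:Z - i%:Z - 1)])
  || (j < m)%N && (val w == cell i%:Z (- 2 - j%:Z) (j%:Z - i%:Z)).
Proof.
have [im jm] := (ltn_ord i, ltn_ord j).
rewrite HC_adjE; move: (val w) => y; rewrite [val _]/= /sector_pt unitsE.
rewrite [has _ _]/= !rot60_cell !cellN !cellD.
rewrite !opprK !subr0.
(* Three of the six points around the corner are corners themselves. *)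
rewrite (cell_notin_hex_ball m (i%:Z - 1)); last by lia.
rewrite (cell_notin_hex_ball m i%:Z (- 1 - j%:Z - 1)); last by lia.
rewrite (cell_notin_hex_ball m i%:Z _ (j%:Z - i%:Z - 1)); last by lia.
rewrite (_ : cell i%:Z (- 1 - j%:Z + 1) (j%:Z - i%:Z) \in hex_ball m);
  last first.
  by rewrite cell_in_hex_ball /in_ball; lia.
rewrite (_ : - 1 - j%:Z - 1 = - 2 - j%:Z); last by lia.
rewrite !cell_in_hex_ball; try lia.
rewrite (_ : in_ball m (i%:Z + 1) _ _ = (i < m)%N && (j < m)%N); last first.
  by rewrite /in_ball; lia.
rewrite (_ : in_ball m i%:Z _ _ = (j < m)%N); last by rewrite /in_ball; lia.
rewrite !inE; case: (i < m)%N; case: (j < m)%N; rewrite /= ?orbF ?andbF //.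
all: by do 3 case: (y == _).
Qed.

Lemma card_fset_vals (K : choiceType) (A : {fset K}) (s : seq K) :
  uniq s -> {subset s <= A} -> #|[set w : A | val w \in s]| = size s.
Proof.
move=> us sA; rewrite cardsE cardE -(size_map val).
apply: perm_size; apply: uniq_perm => //.
  by rewrite map_inj_uniq ?enum_uniq //; apply: val_inj.
move=> x; apply/mapP/idP => [[w]|xs]; first by rewrite mem_enum => h ->.
by exists [` sA x xs]%fset; rewrite ?mem_enum.
Qed.

Lemma rotv_invariant n (F : HC n -> nat) r v :
  (forall w, F (rotv w) = F w) -> F (iter r rotv v) = F v.
Proof. by move=> FE; elim: r => // r <-; rewrite iterS FE. Qed.

(** The three candidates are vertices because each is a corner of a hexagon of
    the ball. *)
Lemma deg_inner m (i j : 'I_m.+1) : (j < m)%N -> deg (sector_vtx i j) = 3%N.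
Proof.
move=> jm; have [im jm1] := (ltn_ord i, ltn_ord j).
pose s := [:: cell (i%:Z - 1) (- 1 - j%:Z) (j%:Z - i%:Z);
  cell i%:Z (- 1 - j%:Z) (j%:Z - i%:Z - 1);
  cell i%:Z (- 2 - j%:Z) (j%:Z - i%:Z)].
rewrite /deg (_ : [set w | _] = [set w : HC m.+1 | val w \in s]); last first.
  by apply/setP => w; rewrite !inE adj_sector jm !inE orbA.
apply: (card_fset_vals _ (HC_vertices m.+1) s) => [|y].
  rewrite /s /= !inE negb_or andbT -!andbA.
  by apply/and3P; split; apply/eqP => /cell_eqP; lia.
have corner p u : p \in hex_ball m -> u \in units -> p + u \in HC_vertices m.+1.
  by move=> pin uin; apply/HC_verticesP; exists p => //; exists u.
rewrite /s !inE => /or3P[] /eqP ->.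
- rewrite (_ : cell _ _ _ = cell i%:Z (- j%:Z) (j%:Z - i%:Z) + cell 0 0 1).
    by apply: corner => //; rewrite cell_in_hex_ball ?/in_ball; lia.
  by rewrite cellD; apply/cell_eqP; lia.
- rewrite (_ : cell _ _ _ = cell i%:Z (- j%:Z) (j%:Z - i%:Z) + cell 1 0 0).
    by apply: corner => //; rewrite cell_in_hex_ball ?/in_ball; lia.
  by rewrite cellD; apply/cell_eqP; lia.
- rewrite (_ : cell _ _ _ =
    cell i%:Z (- 1 - j%:Z) (j%:Z - i%:Z + 1) + cell 1 0 0).
    by apply: corner => //; rewrite cell_in_hex_ball ?/in_ball; lia.
  by rewrite cellD; apply/cell_eqP; lia.
Qed.

(** A boundary vertex (i, -n, m-i), where n = m+1, has two neighbours.  Both lie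
    in the adjacent array, rotated by 300 degrees, except that for i = m the
    second one starts the array on the other side.  Only values of F matter,
    so the rotations disappear from the formula. *)
Lemma sum_adj_rim m (F : HC m.+1 -> nat) (i : 'I_m.+1) :
    (forall w, F (rotv w) = F w) ->
  (\sum_(w | adj (sector_vtx i ord_max) w) F w =
   F (sector_vtx ord_max (rev_ord i)) +
   if i == ord_max then F (sector_vtx ord0 ord_max)
   else F (sector_vtx ord_max (inord (m - i.+1))))%N.
Proof.
move=> FE; have im := ltn_ord i.
pose w1 : HC m.+1 := iter 5 rotv (sector_vtx ord_max (rev_ord i)).
pose w2 : HC m.+1 := if i == ord_max then rotv (sector_vtx ord0 ord_max)
   else iter 5 rotv (sector_vtx ord_max (inord (m - i.+1))).
have v1 : val w1 = cell (i%:Z - 1) (- 1 - m%:Z) (m%:Z - i%:Z).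
  rewrite val_iter_rotv /= /sector_pt !rot60_cell; apply/cell_eqP.
  by rewrite /= subSS; lia.
have v2 : val w2 = cell i%:Z (- 1 - m%:Z) (m%:Z - i%:Z - 1).
  rewrite /w2; case: eqP => [->|/eqP im1].
    rewrite val_rotv /= /sector_pt rot60_cell; apply/cell_eqP.
    by rewrite /=; lia.
  have {}im1 : (i < m)%N by rewrite ltn_neqAle im1 -ltnS im.
  rewrite val_iter_rotv /= /sector_pt !rot60_cell; apply/cell_eqP.
  by rewrite /= inordK; lia.
have w12 : w1 != w2.
  by apply/eqP => /(congr1 val); rewrite v1 v2 => /cell_eqP; lia.
rewrite (eq_bigl (mem [set w1; w2])) => [|w]; last first.
  rewrite adj_sector /= ltnn orbF !inE -v1 -v2.
  by rewrite !(inj_eq val_inj).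
rewrite big_setU1 ?big_set1 ?inE //= /w1 rotv_invariant //; congr addn.
by rewrite /w2; case: eqP => // _; rewrite rotv_invariant.
Qed.

Lemma deg_rim m (i : 'I_m.+1) : deg (sector_vtx i ord_max) = 2%N.
Proof. by rewrite degE sum_adj_rim //; case: eqP. Qed.

Lemma deg_sector m (i j : 'I_m.+1) :
  deg (sector_vtx i j) = (if (j == m :> nat) then 2 else 3)%N.
Proof.
case: eqP => [jm|/eqP jm].
  by rewrite (_ : j = ord_max) ?deg_rim //; apply: val_inj.
by apply: deg_inner; rewrite ltn_neqAle jm -ltnS /=.
Qed.

Lemma deg_rotv n (v : HC n) : deg (rotv v) = deg v.
Proof. exact: (deg_iter_rotv n 1). Qed.

(** Among the boundary vertices j = m of an array, only the first and the last
    have a neighbour of degree 2, namely the end of the array on one side and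
    the start of the array on the other; for m = 0 the two vertices coincide. *)
Lemma sum_rim_deg2 m (i : 'I_m.+1) :
  (\sum_(w | adj (sector_vtx i ord_max) w) (deg w == 2) =
   (i == ord0) + (i == ord_max))%N.
Proof.
rewrite sum_adj_rim => [|w]; last by rewrite deg_rotv.
have im := ltn_ord i.
rewrite !deg_sector /= subSS eqxx -!val_eqE /=.
have -> : (m - i == m)%N = (i == 0 :> nat) by lia.
case: (eqVneq (i : nat) m) => [->|im1]; first by case: (m == 0)%N.
rewrite inordK; last by lia.
have -> : (m - i.+1 == m)%N = false by lia.
by case: (i == 0 :> nat).
Qed.

(** In each of the 6 (m + 1) rows of fixed r and i there are m vertices of
    degree 3 and one of degree 2.  The statement with iterates of the operation
    serves sums and products alike. *)
Lemma big_HC_deg {T} (idx : T) (op : Monoid.com_law idx) m (f : nat -> T) :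
  \big[op/idx]_(v : HC m.+1) f (deg v) =
  iter 6 (op (iter m.+1 (op (op (iter m (op (f 3%N)) idx) (f 2%N))) idx)) idx.
Proof.
rewrite big_HC.
have row r i : \big[op/idx]_(j < m.+1) f (deg (iter r rotv (sector_vtx i j)))
    = op (iter m (op (f 3%N)) idx) (f 2%N).
  rewrite big_ord_recr /= deg_iter_rotv deg_sector eqxx; congr (op _ _).
  under eq_bigr => j _ do rewrite deg_iter_rotv deg_sector /= ltn_eqF //.
  by rewrite big_const_ord.
under eq_bigr => r _ do under eq_bigr => i _ do rewrite row.
by rewrite !big_const_ord.
Qed.

Definition degrees23 (G : sgraph) : Prop :=
  forall v : G, (deg v == 2) || (deg v == 3).

Lemma HC_deg23 m : degrees23 (HC m.+1).
Proof.
move=> v.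
have [r [i [j e]]] := HC_sectors _ _ (valP v).
rewrite (_ : v = iter r rotv (sector_vtx i j)).
  by rewrite deg_iter_rotv deg_sector; case: ifP.
by apply: val_inj; rewrite val_iter_rotv.
Qed.

Lemma sum_indicator (I : finType) (a : I) : (\sum_i (i == a) = 1)%N.
Proof. by rewrite (bigD1 a) //= eqxx big1 // => i /negPf->. Qed.

(** Each of the six edges with both ends of degree 2 is counted from both
    ends. *)
Lemma HC_darts22 m :
  (\sum_(v : HC m.+1) \sum_(w | adj v w) ((deg v == 2) * (deg w == 2)) = 12)%N.
Proof.
rewrite big_HC.
under eq_bigr => r _.
  under eq_bigr => i _.
    under eq_bigr => j _.
      rewrite -big_distrr deg_iter_rotv /= sum_adj_rotv; last first.
        by move=> w; rewrite deg_rotv.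
      over.
    rewrite big_ord_recr /= deg_rim sum_rim_deg2 big1 => [|j _]; last first.
      by rewrite deg_sector /= (ltn_eqF (ltn_ord j)) /= mul0n.
    rewrite mul1n add0n.
    over.
  rewrite big_split /= !sum_indicator.
  over.
by rewrite sum_nat_const card_ord.
Qed.

(** * Edges and degrees in a graph *)

Lemma edgesP (G : sgraph) (e : {set G}) :
  reflect (exists2 p : G * G, adj p.1 p.2 & e = [set p.1; p.2]) (e \in edges G).
Proof. by apply: (iffP imsetP) => -[p padj ->]; exists p. Qed.

Lemma adj_neq (G : sgraph) (u v : G) : adj u v -> u != v.
Proof. by apply: contraTneq => ->; rewrite adj_irr. Qed.

(** Exchange the two operators: the edges at v are the pairs {v, w} with w
    adjacent to v, each obtained from one w. *)
Lemma handshake {T} (idx : T) (op : Monoid.com_law idx) (G : sgraph)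
    (F : G -> {set G} -> T) :
  \big[op/idx]_(e in edges G) \big[op/idx]_(v in e) F v e =
  \big[op/idx]_v \big[op/idx]_(w | adj v w) F v [set v; w].
Proof.
rewrite (exchange_big_dep xpredT) //=; apply: eq_bigr => v _.
rewrite -(big_imset (F v) (h := fun w => [set v; w])
  (A := [pred w | adj v w])) /=.
  apply: eq_bigl => e.
  apply/andP/imsetP => [[/edgesP[[u w] /= uw ->]]|[w vw ->]].
    rewrite !inE => /orP[]/eqP ->; first by exists w.
    by exists u; rewrite 1?setUC // inE adj_sym.
  by split; [apply/edgesP; exists (v, w) | rewrite !inE eqxx].
move=> w w' vw _ /setP/(_ w); rewrite !inE eqxx orbT => /esym/orP[]/eqP // wv.
by move: vw; rewrite inE wv adj_irr.
Qed.

Definition edge_deg {G : sgraph} (e : {set G}) : nat := (\sum_(v in e) deg v)%N.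

Lemma edge_deg_pair (G : sgraph) (u v : G) : adj u v ->
  edge_deg [set u; v] = (deg u + deg v)%N.
Proof. by move=> uv; rewrite /edge_deg big_setU1 ?big_set1 ?inE ?adj_neq. Qed.

Definition edge_num (G : sgraph) (s : nat) : nat :=
  #|[set e in edges G | edge_deg e == s]|.

Lemma edge_deg456 (G : sgraph) (e : {set G}) :
  degrees23 G -> e \in edges G -> edge_deg e \in [:: 4; 5; 6].
Proof.
move=> deg23 /edgesP[[u v] /= uv ->]; rewrite edge_deg_pair //.
by case/orP: (deg23 u) => /eqP->; case/orP: (deg23 v) => /eqP->.
Qed.

Lemma big_edges456 {T} (idx : T) (op : Monoid.com_law idx) (G : sgraph)
    (f : nat -> T) : degrees23 G ->
  \big[op/idx]_(e in edges G) f (edge_deg e) =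
  op (iter (edge_num G 4) (op (f 4%N)) idx)
    (op (iter (edge_num G 5) (op (f 5%N)) idx)
      (iter (edge_num G 6) (op (f 6%N)) idx)).
Proof.
move=> deg23.
have part s (P : pred {set G}) :
    (forall e, e \in edges G -> P e = (edge_deg e == s)) ->
    \big[op/idx]_(e in edges G | P e) f (edge_deg e) =
    iter (edge_num G s) (op (f s)) idx.
  move=> PE; rewrite /edge_num -big_const; apply: eq_big => e.
    by rewrite !inE; have [/PE->|] := boolP (e \in edges G).
  by case/andP=> eG; rewrite PE // => /eqP->.
rewrite (bigID (fun e => edge_deg e == 4)) /= (part 4%N) //; congr (op _ _).
rewrite (bigID (fun e => edge_deg e == 5)) /=; congr (op _ _).
  rewrite -(part 5%N (fun e => edge_deg e == 5)) //; apply: eq_bigl => e.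
  by rewrite -andbA; congr andb; case: eqP => // ->.
rewrite -(part 6%N (fun e => edge_deg e == 6)) //; apply: eq_bigl => e.
rewrite -andbA; have [/(edge_deg456 _ _ deg23)|//] := boolP (e \in edges G).
by rewrite !inE => /or3P[] /eqP->.
Qed.

Lemma sum_edge_deg (G : sgraph) (f : nat -> nat) : degrees23 G ->
  (\sum_(e in edges G) f (edge_deg e) =
   edge_num G 4 * f 4 + edge_num G 5 * f 5 + edge_num G 6 * f 6)%N.
Proof.
by move=> deg23; rewrite big_edges456 //= !iter_addn_0 addnA -!(mulnC (f _)).
Qed.

Lemma edge_num_total (G : sgraph) : degrees23 G ->
  (2 * (edge_num G 4 + edge_num G 5 + edge_num G 6) = \sum_(v : G) deg v)%N.
Proof.
move=> deg23.
have -> : (\sum_(v : G) deg v =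
    \sum_(e in edges G) \sum_(v in e) 1)%N.
  by rewrite handshake; apply: eq_bigr => v _; rewrite sum1_card /deg cardsE.
rewrite (eq_bigr (fun=> 2%N)) => [|e /edgesP[p /adj_neq pp ->]].
  by rewrite (sum_edge_deg _ (fun=> 2%N)) //; lia.
by rewrite sum1_card cards2 pp.
Qed.

Lemma edge_num_weighted (G : sgraph) : degrees23 G ->
  (4 * edge_num G 4 + 5 * edge_num G 5 + 6 * edge_num G 6 =
   \sum_(v : G) deg v * deg v)%N.
Proof.
move=> deg23.
have -> : (\sum_(v : G) deg v * deg v =
    \sum_(e in edges G) edge_deg e)%N.
  rewrite handshake; apply: eq_bigr => v _.
  by rewrite sum_nat_const /deg cardsE.
by rewrite (sum_edge_deg _ id) //; lia.
Qed.

(** An edge has degree sum 4 exactly when both its ends have degree 2, and it is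
    then counted from each of them. *)
Lemma edge_num4 (G : sgraph) : degrees23 G ->
  (2 * edge_num G 4 =
   \sum_(v : G) \sum_(w | adj v w) (deg v == 2) * (deg w == 2))%N.
Proof.
move=> deg23.
have -> : (\sum_(v : G) \sum_(w | adj v w) (deg v == 2) * (deg w == 2) =
    \sum_(e in edges G) \sum_(v in e) (edge_deg e == 4))%N.
  rewrite handshake; apply: eq_bigr => v _; apply: eq_bigr => w vw.
  rewrite edge_deg_pair //.
  by case/orP: (deg23 v) => /eqP->; case/orP: (deg23 w) => /eqP->.
rewrite (eq_bigr (fun e => 2 * (edge_deg e == 4))%N) => [|e /edgesP[p pp e2]].
  by rewrite (sum_edge_deg _ (fun s => 2 * (s == 4))%N) //; lia.
by rewrite sum_nat_const {1}e2 cards2 adj_neq.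
Qed.

(** * The indices of the network *)

(** The three handshake equations form an invertible linear system in the three
    numbers, whose right-hand sides are sums over the vertices. *)
Lemma HC_edge_nums m :
  [/\ edge_num (HC m.+1) 4 = 6, edge_num (HC m.+1) 5 = (12 * m)%N
    & edge_num (HC m.+1) 6 = (3 * m * (3 * m + 1))%N].
Proof.
have e4 := edge_num4 _ (@HC_deg23 m).
have et := edge_num_total _ (@HC_deg23 m).
have ew := edge_num_weighted _ (@HC_deg23 m).
rewrite HC_darts22 in e4.
rewrite (big_HC_deg _ _ _ id) !iter_addn_0 /= in et.
rewrite (big_HC_deg _ _ _ (fun d => d * d)%N) !iter_addn_0 /= in ew.
by split; nia.
Qed.

Lemma HC_Pi2 m : Pi2 (HC m.+1) = (2 ^ (12 * m.+1) * 3 ^ (18 * m * m.+1))%N.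
Proof.
rewrite /Pi2 handshake.
under eq_bigr => v _ do rewrite prod_nat_const.
rewrite (eq_bigr (fun v => deg v ^ deg v)%N) => [|v _]; last first.
  by rewrite /deg cardsE.
rewrite (big_HC_deg _ _ _ (fun d => d ^ d)%N) !iter_muln_1.
rewrite !expnMn -!expnM mulnC -!expnD.
by congr (_ ^ _ * _ ^ _)%N; lia.
Qed.

Lemma HC_Pi1star m : Pi1star (HC m.+1) =
  (4 ^ 6 * 5 ^ (12 * m) * 6 ^ (3 * m * (3 * m + 1)))%N.
Proof.
have [m4 m5 m6] := HC_edge_nums m.
rewrite /Pi1star (big_edges456 _ _ _ id (HC_deg23 m)) !iter_muln_1 m4 m5 m6.
by rewrite /= mulnA.
Qed.

Lemma HC_chi (R : realType) (alpha : R) m : chi alpha (HC m.+1) =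
  6 * 4 `^ alpha + 12 * m%:R * 5 `^ alpha
  + 3 * m%:R * (3 * m%:R + 1) * 6 `^ alpha.
Proof.
have [m4 m5 m6] := HC_edge_nums m.
rewrite /chi (big_edges456 _ _ _ (fun s => s%:R `^ alpha) (HC_deg23 m)).
rewrite /= !iter_addr_0 m4 m5 m6 addrA -!(mulr_natl (_ `^ _)).
by rewrite !(natrM, natrD).
Qed.

Lemma HC_Pi1 (R : realType) (c : R) m : Pi1 c (HC m.+1) =
  (2 `^ c) ^+ (6 * m.+1) * (3 `^ c) ^+ (6 * m * m.+1).
Proof.
rewrite /Pi1 (big_HC_deg _ _ _ (fun d => d%:R `^ c)).
rewrite !iter_mulr_1 /= !exprMn -!exprM mulrC.
by congr (_ ^+ _ * _ ^+ _); lia.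
Qed.

Theorem theorem2p5p1 (R : realType) (n : nat) (alpha c : R) (hn : (1 <= n)%N) :
  [/\ Pi1 c (HC n) =
        2 `^ (6 * n%:R * c) * 3 `^ (6 * n%:R ^+ 2 * c - 6 * n%:R * c),
      (Pi2 (HC n))%:R =
        2 ^ (12 * n%:Z) * 3 ^ (18 * n%:Z ^+ 2 - 18 * n%:Z) :> R,
      chi alpha (HC n) =
        3 * 2 `^ (2 * alpha + 1) + 12 * (n%:R - 1) * 5 `^ alpha
        + 2 `^ alpha * 3 `^ (alpha + 1) * (3 * n%:R ^+ 2 - 5 * n%:R + 2)
    & (Pi1star (HC n))%:R =
        2 ^ (9 * n%:Z ^+ 2 - 15 * n%:Z + 18)
        * 3 ^ (9 * n%:Z ^+ 2 - 15 * n%:Z + 6)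
        * 5 ^ (12 * (n%:Z - 1)) :> R].
Proof.
case: n hn => // m _; split.
- rewrite HC_Pi1 -!(powR_mulrn _ (powR_ge0 _ _)) -!powRrM.
  by congr (_ `^ _ * _ `^ _); rewrite !natrM -(natr1 m); ring.
- rewrite HC_Pi2 natrM !natrX.
  have -> : 12 * m.+1%:Z = (12 * m.+1)%N by lia.
  have -> : 18 * m.+1%:Z ^+ 2 - 18 * m.+1%:Z = (18 * m * m.+1)%N by nia.
  by [].
- rewrite HC_chi.
  (* Reduce to the independent quantities 2 `^ alpha, 3 `^ alpha, 5 `^ alpha. *)
  have -> : 4 `^ alpha = 2 `^ alpha ^+ 2 :> R.
    by rewrite expr2 -powRM ?ler0n //; congr (_ `^ _); ring.
  have -> : 6 `^ alpha = 2 `^ alpha * 3 `^ alpha :> R.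
    by rewrite -powRM ?ler0n //; congr (_ `^ _); ring.
  rewrite !powRD ?pnatr_eq0 ?implybT // !powRr1 ?ler0n //.
  rewrite (_ : 2 * alpha = alpha + alpha); last by ring.
  rewrite powRD ?pnatr_eq0 ?implybT //.
  by rewrite -(natr1 m); ring.
- rewrite HC_Pi1star !natrM !natrX.
  have -> : 9 * m.+1%:Z ^+ 2 - 15 * m.+1%:Z + 18 =
    (12 + 3 * m * (3 * m + 1))%N by nia.
  have -> : 9 * m.+1%:Z ^+ 2 - 15 * m.+1%:Z + 6 = (3 * m * (3 * m + 1))%N.
    by nia.
  have -> : 12 * (m.+1%:Z - 1) = (12 * m)%N by lia.
  rewrite -!exprnP (_ : 6 = 2 * 3 :> R); last by ring.
  by rewrite exprMn exprD; ring.
Qed.
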